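(* Let $A$ be a finite alphabet of size at least $2$, and let $k$ and $m$ be positive integers. Then the set of $A$-generated, $k$-relation monoid presentations which satisfy the small overlap condition $C(m)$ is generic with respect to the sum length stratification; that is, the proportion of $A$-generated $k$-relation monoid presentations of sum length $n$ which satisfy $C(m)$ tends to $1$ as $n \to \infty$.
   Context: An $A$-generated $k$-relation monoid presentation $\langle A \mid R\rangle$ consists of the finite alphabet $A$ and a finite sequence $R$ of $k$ ordered pairs of words $(u_1,v_1),\dots,(u_k,v_k) \in A^*\times A^*$. The words $u_1,v_1,\dots,u_k,v_k$ are the relation words; relation words at different positions count as different occurrences even if equal as words. A piece is a word which appears more than once as a factor (contiguous subword) in the relations, either as a factor of two different relation words, or as a factor of the same relation word in two different (possibly overlapping) places. The presentation satisfies $C(m)$ if no relation word can be written as a product of strictly fewer than $m$ pieces (the empty word being the product of zero pieces; so $C(1)$ says that no relation word is empty). The sum length of a presentation is the sum of the lengths of its $2k$ relation words. The sum length stratification of the set $S$ of $A$-generated $k$-relation presentations is the sequence $(S_n)$ where $S_n$ is the (finite) set of those of sum length $n$. A subset $X\subseteq S$ is generic if $\lim_{n\to\infty} |X\cap S_n|/|S_n| = 1$. *)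

(* Defs.v *)
From HB Require Import structures.
From mathcomp Require Import all_boot all_order all_algebra.
From mathcomp Require Import finmap.
From mathcomp Require Import all_classical all_reals all_analysis.
Set Implicit Arguments.
Unset Strict Implicit.
Unset Printing Implicit Defensive.
Import Order.TTheory GRing.Theory Num.Theory.
Import numFieldNormedType.Exports.
Local Open Scope classical_set_scope.
Local Open Scope ring_scope.

Definition presentation (A : finType) (k : nat) : choiceType :=
  k.-tuple (seq A * seq A).

(* Relation words are indexed by position: (i, false) is the left-hand side and
   (i, true) the right-hand side of the i-th relation, so that equal words at
   different positions remain distinct occurrences. *)
Definition relword (A : finType) (k : nat) (P : presentation A k)
    (j : 'I_k * bool) : seq A :=
  if j.2 then (tnth P j.1).2 else (tnth P j.1).1.

(* w is a factor of u starting at place p, i.e. after a prefix of length p. *)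
Definition factor_at (A : finType) (w u : seq A) (p : nat) : Prop :=
  exists s t : seq A, u = s ++ w ++ t /\ size s = p.

Definition piece (A : finType) (k : nat) (P : presentation A k) (w : seq A)
    : Prop :=
  exists (j1 j2 : 'I_k * bool) (p1 p2 : nat),
    [/\ (j1, p1) <> (j2, p2),
        factor_at w (relword P j1) p1
      & factor_at w (relword P j2) p2].

Definition small_overlap (A : finType) (k : nat) (m : nat)
    (P : presentation A k) : Prop :=
  forall j : 'I_k * bool,
    ~ exists ps : seq (seq A),
        [/\ (size ps < m)%N,
            forall w : seq A, w \in ps -> piece P w
          & relword P j = flatten ps].

Definition sum_length (A : finType) (k : nat) (P : presentation A k) : nat :=
  (\sum_(j : 'I_k * bool) size (relword P j))%N.

Definition sum_length_strat (A : finType) (k : nat) (n : nat)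
    : set (presentation A k) :=
  [set P | sum_length P = n].

(* fset_set is empty on infinite sets; this rules out that default value. *)
Lemma finite_sum_length_strat (A : finType) (k n : nat) :
  finite_set (@sum_length_strat A k n).
Proof.
pose f (t : k.-tuple (n.-bseq A * n.-bseq A)) : presentation A k :=
  [tuple of [seq (bseqval x.1, bseqval x.2) | x <- t]].
apply: (@sub_finite_set _ _ (f @` setT)); last exact/finite_image/finite_finset.
move=> P /= hP.
have hle j : (size (relword P j) <= n)%N.
  by rewrite -hP /sum_length (bigD1 j)//= leq_addr.
exists [tuple (insub_bseq n (tnth P i).1, insub_bseq n (tnth P i).2) | i < k].
  by [].
apply: eq_from_tnth => i; rewrite tnth_map tnth_mktuple /=.
rewrite /insub_bseq !insubdK.
- by case: (tnth P i).
- exact: (hle (i, true)).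
- exact: (hle (i, false)).
Qed.

Definition generic (R : realType) (S : choiceType) (strat : nat -> set S)
    (X : set S) : Prop :=
  (fun n : nat => #|` fset_set (X `&` strat n)|%:R
                  / #|` fset_set (strat n)|%:R : R) @ \oo --> (1 : R).

(* Main.v *)
(* Fix a length l. A presentation violating C(m) either has a relation word shorter
   than m * l or has a piece of length at least l. For the first kind, moving
   multiples of m * l letters from a long relation word to the short one embeds c
   copies of the set of such presentations into K^2 copies of S_n (K = 2k). For the
   second kind, overwriting the second occurrence of the piece by an arbitrary word
   of length l embeds |A|^l copies into (K(n+1))^2 copies of S_n. Both kinds are
   negligible when l is a small enough multiple of n. *)
Require Import Defs.
From mathcomp Require Import all_boot all_order all_algebra.
From mathcomp Require Import finmap zify.
From mathcomp Require Import all_classical all_reals all_analysis.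
Import Order.TTheory GRing.Theory Num.Theory.
Local Open Scope classical_set_scope.

(** * Counting by reversible encodings *)

(** After one admissible label [j] is chosen for each [x], the map sending [(x, i)] to
    [(j, g j x i)] is injective into [J * Y]. Since the label is part of the code, decoding only has
    to work for two inputs sharing the same [j]. *)
Lemma leq_card_encoding (S : choiceType) (I J : finType) (X Y : {fset S})
    (Q : S -> J -> Prop) (g : J -> S -> I -> S) :
  (forall x, x \in X -> exists j, Q x j) ->
  (forall x j i, x \in X -> Q x j -> g j x i \in Y) ->
  (forall x x' j i i', x \in X -> x' \in X -> Q x j -> Q x' j ->
     g j x i = g j x' i' -> x = x' /\ i = i') ->
  (#|` X| * #|I| <= #|J| * #|` Y|)%N.
Proof.
move=> exQ gY ginj.
(* Values in [option J] make the choice total: off [X] there may be no label, and [J] may even be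
   empty. *)
have [h hQ] : exists h : S -> option J,
    forall x, x \in X -> exists2 j, h x = Some j & Q x j.
  suff /choice [h hP] : forall x, exists o : option J,
      x \in X -> exists2 j, o = Some j & Q x j by exists h.
  move=> x; case: (boolP (x \in X)) => [/exQ [j Qj]|_]; last by exists None.
  by exists (Some j) => _; exists j.
pose f x i := omap (fun j => (j, g j x i)) (h x).
have -> : (#|` X| * #|I| = size [seq f x i | x <- X, i <- enum I])%N.
  by rewrite size_allpairs cardE.
have -> : (#|J| * #|` Y| = size [seq Some (j, y) | j <- enum J, y <- Y])%N.
  by rewrite size_allpairs cardE.
apply: uniq_leq_size.
  apply: allpairs_uniq => //; [exact: enum_uniq|].
  move=> _ _ /allpairsP [[x i] [/= xX _ ->]] /allpairsP [[x' i'] [/= x'X _ ->]].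
  rewrite /f /=; have [j -> Qj] := hQ _ xX; have [j' -> Qj'] := hQ _ x'X.
  case=> ejj'; move: Qj'; rewrite -ejj' => Qj' e.
  by have [-> ->] := ginj _ _ _ _ _ xX x'X Qj Qj' e.
move=> _ /allpairsP [[x i] [/= xX _ ->]].
rewrite /f; have [j -> Qj] := hQ _ xX.
by apply/allpairsP; exists (j, g j x i); split=> //=; [rewrite mem_enum|exact: gY].
Qed.

(** * Presentations as families of words indexed by position *)

Section Presentations.
Variables (A : finType) (k : nat).
Implicit Types (P Q : presentation A k) (j : 'I_k * bool).

Definition mk_presentation (h : 'I_k * bool -> seq A) : presentation A k :=
  [tuple (h (i, false), h (i, true)) | i < k].

Lemma relword_mk h j : relword (mk_presentation h) j = h j.
Proof. by case: j => i []; rewrite /relword /= tnth_mktuple. Qed.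

Lemma presentation_ext P Q : (forall j, relword P j = relword Q j) -> P = Q.
Proof.
move=> e; apply: eq_from_tnth => i.
have := e (i, false); have := e (i, true); rewrite /relword /=.
by case: (tnth P i) => ? ?; case: (tnth Q i) => ? ? /= -> ->.
Qed.

Definition strat_fset (n : nat) : {fset presentation A k} :=
  fset_set (@sum_length_strat A k n).

Lemma mem_strat n P : (P \in strat_fset n) = (sum_length P == n).
Proof.
rewrite in_fset_set; last exact: finite_sum_length_strat.
by apply/idP/eqP; rewrite inE.
Qed.

Lemma size_relword P j : (size (relword P j) <= sum_length P)%N.
Proof. by rewrite /sum_length (bigD1 j) //= leq_addr. Qed.

(** * Presentations with a short relation word *)

Definition has_short_word (L : nat) P := [exists j, size (relword P j) < L]%N.

Definition transfer (d : nat) j j' P : presentation A k :=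
  mk_presentation (fun i =>
    if i == j then relword P j ++ take d (relword P j')
    else if i == j' then drop d (relword P j') else relword P i).

Lemma sum_length_transfer d j j' P : j != j' ->
  (d <= size (relword P j'))%N -> sum_length (transfer d j j' P) = sum_length P.
Proof.
move=> nj ld; rewrite /sum_length (bigD1 j) //= [RHS](bigD1 j) //=.
rewrite (bigD1 j') 1?eq_sym //= [in RHS](bigD1 j') 1?eq_sym //=.
rewrite !relword_mk eqxx eq_sym (negPf nj) eqxx size_cat size_takel //.
rewrite size_drop [X in (_ + (_ + X))%N = _](eq_bigr (fun i => size (relword P i))).
  lia.
by move=> i /andP [/negPf ni /negPf ni']; rewrite relword_mk ni ni'.
Qed.

(* With [j'] a long word, moving [t * L] letters from [j'] to the short word [j]
   is reversible: [t] and the old size are the quotient and remainder by [L] of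
   the new size of word [j]. *)
Lemma card_short_word (n c L : nat) : (0 < c)%N -> (0 < L)%N ->
  (#|{: 'I_k * bool}| * (c * L) <= n)%N ->
  (#|` [fset P in strat_fset n | has_short_word L P]%fset| * c <=
    #|{: 'I_k * bool}| ^ 2 * #|` strat_fset n|)%N.
Proof.
move=> c0 L0 hn.
have -> : (#|{: 'I_k * bool}| ^ 2 = #|{: ('I_k * bool) * ('I_k * bool)}|)%N.
  by rewrite [RHS]card_prod mulnn.
rewrite -[X in (_ * X <= _)%N]card_ord.
pose Q P (jj : ('I_k * bool) * ('I_k * bool)) :=
  (size (relword P jj.1) < L)%N && (c * L <= size (relword P jj.2))%N.
have neqQ P jj : Q P jj -> jj.1 != jj.2.
  by move=> /andP [h1 h2]; apply/eqP => e; rewrite -e in h2; nia.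
have tL (t : 'I_c) P jj : Q P jj -> (t * L <= size (relword P jj.2))%N.
  by move=> /andP [_]; apply: leq_trans; rewrite leq_mul2r ltnW ?orbT.
apply: (@leq_card_encoding _ 'I_c (('I_k * bool) * ('I_k * bool))%type _ _
   (fun P jj => Q P jj) (fun jj P t => transfer (t * L) jj.1 jj.2 P)).
- move=> P; rewrite !inE mem_strat /= => /andP [/eqP Pn /existsP [j hj]].
  have [/existsP [j' hj']|/existsPn no] :=
      boolP [exists j', c * L <= size (relword P j')]%N.
    by exists (j, j'); apply/andP.
  (* Pigeonhole: if every word had fewer than [c * L] letters, the total would stay below the number
     of words times [c * L], hence below [n]. *)
  have : (sum_length P <= \sum_(j : 'I_k * bool) (c * L).-1)%N.
    by apply: leq_sum => i _; have := no i; rewrite -ltnNge; case: (c * L)%N.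
  rewrite sum_nat_const Pn => /(leq_trans hn).
  rewrite leq_pmul2l; last by apply/card_gt0P; exists j.
  by rewrite -ltnS prednK ?ltnn // muln_gt0 c0 L0.
- move=> P jj t; rewrite !inE !mem_strat /= => /andP [/eqP Pn _] QP.
  by rewrite sum_length_transfer ?Pn ?(neqQ _ _ QP) ?(tL _ _ _ QP).
- move=> P P' jj t t' _ _ QP QP' e.
  have /andP [sP _] := QP; have /andP [sP' _] := QP'.
  have nj := neqQ _ _ QP.
  have e1 := congr1 (fun P => relword P jj.1) e.
  have e2 := congr1 (fun P => relword P jj.2) e.
  move: e1 e2; rewrite /= !relword_mk !eqxx eq_sym (negPf nj) => e1 e2.
  have := congr1 size e1; rewrite !size_cat !size_takel ?(tL _ _ _ QP) ?(tL _ _ _ QP') // => es.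
  have ett : t = t' :> nat.
    have := congr1 (divn^~ L) es.
    by rewrite /= ![(_ + _ * L)%N]addnC !divnMDl // !divn_small // !addn0.
  have et : t = t' by exact: val_inj.
  subst t'; split=> //.
  move/eqP: e1; rewrite eqseq_cat; last exact: addIn es.
  move=> /andP [/eqP e1 /eqP e3].
  apply: presentation_ext => i.
  have [->//|ni] := eqVneq i jj.1.
  have [->|ni'] := eqVneq i jj.2.
    by rewrite -(cat_take_drop (t * L) (relword P _)) e2 e3 cat_take_drop.
  have := congr1 (fun P => relword P i) e.
  by rewrite /= !relword_mk (negPf ni) (negPf ni').
Qed.

(** * Presentations with a long piece *)

Definition overwrite (u : seq A) j (p : nat) P : presentation A k :=
  mk_presentation (fun i =>
    if i == j then take p (relword P j) ++ u ++ drop (p + size u) (relword P j)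
    else relword P i).

Lemma sum_length_overwrite u j p P :
  (p + size u <= size (relword P j))%N ->
  sum_length (overwrite u j p P) = sum_length P.
Proof.
move=> h; rewrite /sum_length; apply: eq_bigr => i _.
rewrite relword_mk; case: eqP => // ->.
rewrite !size_cat size_drop size_takel; lia.
Qed.

(** Within one word the first occurrence must start strictly to the left, so that letters can be
    recovered from left to right; overlaps are allowed. The size bounds keep [nth] away from its
    default [x0]. *)
Definition repeats (x0 : A) (l : nat) P j1 (p1 : nat) j2 (p2 : nat) :=
  [/\ (j1 != j2) || (p1 < p2)%N, (p1 + l <= size (relword P j1))%N,
      (p2 + l <= size (relword P j2))%N
    & forall i, (i < l)%N ->
        nth x0 (relword P j1) (p1 + i) = nth x0 (relword P j2) (p2 + i)].

(** Both occurrences are truncated to the first [l] letters of the piece, and exchanged if they lie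
    in the same word in the wrong order. *)
Lemma piece_repeats x0 l w P : piece P w -> (l <= size w)%N ->
  exists j1 p1 j2 p2, repeats x0 l P j1 p1 j2 p2.
Proof.
have fac u p : factor_at w u p -> (l <= size w)%N -> (p + l <= size u)%N /\
    forall i, (i < l)%N -> nth x0 u (p + i) = nth x0 w i.
  move=> [s [t [-> <-]]] lw; split; first by rewrite !size_cat; lia.
  move=> i il; rewrite nth_cat ltnNge leq_addr /= addKn nth_cat.
  by rewrite (leq_trans il lw).
move=> [j1 [j2 [p1 [p2 [ne f1 f2]]]]] lw.
have [s1 n1] := fac _ _ f1 lw; have [s2 n2] := fac _ _ f2 lw.
have [e|nj] := eqVneq j1 j2; last first.
  by exists j1, p1, j2, p2; split; rewrite ?nj // => i il; rewrite n1 // n2.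
have [lt|lt|ep] := ltngtP p1 p2.
- by exists j1, p1, j2, p2; split; rewrite ?lt ?orbT // => i il; rewrite n1 // n2.
- by exists j2, p2, j1, p1; split; rewrite ?lt ?orbT // => i il; rewrite n1 // n2.
- by case: ne; rewrite e ep.
Qed.

(* The overwritten factor is recovered from left to right: each of its letters
   equals one of the first occurrence, which was either never overwritten or has
   already been recovered. *)
Lemma overwrite_inj x0 (u u' : seq A) P P' j1 p1 j2 p2 :
  size u = size u' ->
  repeats x0 (size u) P j1 p1 j2 p2 -> repeats x0 (size u) P' j1 p1 j2 p2 ->
  overwrite u j2 p2 P = overwrite u' j2 p2 P' -> P = P' /\ u = u'.
Proof.
move=> su [lt s1 s2 r] [_ s1' s2' r'] e.
have eo i : i != j2 -> relword P i = relword P' i.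
  move=> ni; have := congr1 (fun P => relword P i) e.
  by rewrite /= !relword_mk (negPf ni).
have := congr1 (fun P => relword P j2) e.
rewrite /= !relword_mk eqxx => /eqP.
rewrite eqseq_cat; last by rewrite !size_takel ?(leq_trans (leq_addr _ _) s2) ?(leq_trans (leq_addr _ _) s2').
move=> /andP [/eqP et]; rewrite eqseq_cat // => /andP [/eqP eu /eqP ed].
split=> //; rewrite -su in ed.
have en q : (q < p2 + size u)%N ->
    nth x0 (relword P j2) q = nth x0 (relword P' j2) q.
  elim/ltn_ind: q => q IH lq.
  have [lp|lp] := ltnP q p2.
    by rewrite -(nth_take x0 lp) et nth_take.
  have li : (q - p2 < size u)%N by lia.
  rewrite -(subnKC lp) -r // -r' //.
  have [e12|/eo -> //] := eqVneq j1 j2.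
  move: lt; rewrite e12 eqxx /= => lt.
  by apply: IH; lia.
apply: presentation_ext => i; have [->|/eo //] := eqVneq i j2.
rewrite -(cat_take_drop (p2 + size u) (relword P j2)) ed.
rewrite -[RHS](cat_take_drop (p2 + size u)); congr (_ ++ _).
apply: (@eq_from_nth _ x0); rewrite !size_takel // => q lq.
by rewrite !nth_take // en.
Qed.

Definition has_long_piece (l : nat) P :=
  `[< exists2 w, piece P w & (l <= size w)%N >].

Lemma card_long_piece (n l : nat) (x0 : A) :
  (#|` [fset P in strat_fset n | has_long_piece l P]%fset| * #|A| ^ l <=
    (#|{: 'I_k * bool}| * n.+1) ^ 2 * #|` strat_fset n|)%N.
Proof.
(* A label locates one occurrence by word and starting position; positions range over [0..n], which
   gives [n.+1] choices. *)
pose J := (('I_k * bool) * 'I_n.+1)%type.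
have -> : ((#|{: 'I_k * bool}| * n.+1) ^ 2 = #|{: J * J}|)%N.
  by rewrite /J !card_prod !card_ord mulnn.
rewrite -card_tuple.
apply: (@leq_card_encoding _ (l.-tuple A) (J * J)%type _ _
  (fun P (z : J * J) => repeats x0 l P z.1.1 z.1.2 z.2.1 z.2.2)
  (fun (z : J * J) P (u : l.-tuple A) => overwrite u z.2.1 z.2.2 P)).
- move=> P; rewrite !inE mem_strat /= => /andP [/eqP Pn /asboolP [w pw lw]].
  have [j1 [p1 [j2 [p2 rep]]]] := piece_repeats x0 _ _ _ pw lw.
  have [_ s1 s2 _] := rep.
  have l1 : (p1 < n.+1)%N by have := size_relword P j1; lia.
  have l2 : (p2 < n.+1)%N by have := size_relword P j2; lia.
  by exists ((j1, Ordinal l1), (j2, Ordinal l2)).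
- move=> P z u; rewrite !inE !mem_strat /= => /andP [/eqP Pn _] [_ _ s2 _].
  by rewrite sum_length_overwrite ?Pn // size_tuple.
- move=> P P' z u u' _ _ rP rP' e.
  have [||//||-> /val_inj ->] := @overwrite_inj x0 u u' P P' z.1.1 z.1.2 z.2.1 z.2.2;
    by rewrite ?size_tuple.
Qed.

(** * The two ways of violating $C(m)$, and nonempty strata *)

(** If all pieces are shorter than [l], a product of fewer than [m] of them has fewer than [m * l]
    letters, so it cannot equal a word that is not short. *)
Lemma not_small_overlap (m l : nat) P : (0 < m)%N -> (0 < l)%N ->
  ~ small_overlap m P -> has_short_word (m * l) P || has_long_piece l P.
Proof.
move=> m0 l0 nso; apply/orP.
have [|/asboolPn nl] := boolP (has_long_piece l P); first by right.
left; apply: contra_notT nso => /existsPn long j [ps [sps pps e]].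
have := long j; rewrite e -leqNgt size_flatten /shape.
have : (sumn [seq size w | w <- ps] <= size ps * l)%N.
  elim: ps pps {sps e} => //= w ps IH pps.
  rewrite mulSn leq_add ?IH //; last by move=> v vp; apply: pps; rewrite inE vp orbT.
  rewrite leqNgt; apply/negP => lw; apply: nl; exists w; last exact: ltnW.
  by apply: pps; rewrite mem_head.
move=> h1 h2; have := leq_trans h2 h1.
by rewrite leq_pmul2r // leqNgt sps.
Qed.

(** This keeps the denominator of the proportion nonzero. The witness puts all [n] letters into a
    single relation word. *)
Lemma strat_gt0 (n : nat) : (0 < #|A|)%N -> (0 < k)%N -> (0 < #|` strat_fset n|)%N.
Proof.
move=> /card_gt0P [a _] k0; rewrite cardfs_gt0; apply/fset0Pn.
pose j0 : 'I_k * bool := (Ordinal k0, false).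
exists (mk_presentation (fun j => if j == j0 then nseq n a else [::])).
rewrite mem_strat /sum_length (bigD1 j0) //= relword_mk eqxx size_nseq.
rewrite big1 ?addn0 // => j /negPf nj; by rewrite relword_mk nj.
Qed.

End Presentations.

(** * Choice of the length [l] and passage to the limit *)

(** A length linear in [n] meets both demands: [2 ^ l] beats the polynomial cost of encoding a long
    piece, while [D * l <= n] leaves enough letters to transfer. *)
Lemma exists_scale (C D : nat) : (0 < C)%N -> (0 < D)%N ->
  exists N, forall n, (N <= n)%N -> exists l,
    [/\ (0 < l)%N, (C * n.+1 ^ 2 <= 2 ^ l)%N & (D * l <= n)%N].
Proof.
(* [E] is chosen so that [n.+1 <= 4 * D * a.+1] gives [C * n.+1 ^ 2 <= E * a.+1 ^ 2]. The threshold
   on [n] forces [E <= a], so this is at most [a.+1 ^ 4 <= 2 ^ (4 * a)]. *)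
move=> C0 D0; pose E := (16 * C * D ^ 2)%N; exists (4 * D * E)%N => n hn.
pose a := (n %/ (4 * D))%N.
have d0 : (0 < 4 * D)%N by rewrite muln_gt0.
have Ea : (E <= a)%N by rewrite leq_divRL // mulnC.
have E0 : (0 < E)%N by rewrite !muln_gt0 C0 D0.
have na : (n.+1 <= 4 * D * a.+1)%N by rewrite mulnC ltn_ceil.
exists (4 * a)%N; split; first by lia.
- have a2 : (a.+1 <= 2 ^ a)%N by rewrite ltn_expl.
  rewrite [(4 * a)%N]mulnC expnM.
  apply: (@leq_trans (a.+1 ^ 4)); last by rewrite leq_exp2r.
  apply: (@leq_trans (E * a.+1 ^ 2)).
    apply: (@leq_trans (C * (4 * D * a.+1) ^ 2)).
      by rewrite leq_mul2l leq_exp2r // na orbT.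
    by rewrite /E; lia.
  rewrite -[4%N]/(2 + 2)%N expnD leq_mul2r; apply/orP; right.
  by apply: leq_trans Ea _; nia.
- by have := leq_trunc_div n (4 * D); rewrite -/a; lia.
Qed.

(** Division-free form of the limit: each of the two kinds of violation fills at most a share
    [1 / (2 * c)] of the stratum, for [c] as large as desired. *)
Lemma bad_negligible (A : finType) (k m c : nat) :
  (1 < #|A|)%N -> (0 < k)%N -> (0 < m)%N -> (0 < c)%N ->
  exists N, forall n, (N <= n)%N ->
   (c * #|` [fset P in strat_fset A k n | `[< ~ small_overlap m P >]]%fset|
     <= #|` strat_fset A k n|)%N.
Proof.
move=> A1 k0 m0 c0; pose K := #|{: 'I_k * bool}|.
have K0 : (0 < K)%N by apply/card_gt0P; exists (Ordinal k0, true).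
have /card_gt0P [x0 _] : (0 < #|A|)%N by exact: ltnW.
(* The factor [K ^ 2] pays for the labels of both encodings, and the factor 2 for adding up the two
   kinds of violation. *)
pose c1 := (2 * c * K ^ 2)%N.
have c10 : (0 < c1)%N by rewrite !muln_gt0 c0 K0.
have d0 : (0 < K * c1 * m)%N by rewrite muln_gt0 muln_gt0 K0 c10.
have [N hN] := exists_scale _ _ c10 d0.
exists N => n /hN [l [l0 hl1 hl2]].
have b1 := @card_short_word A k n c1 (m * l) c10.
have b2 := @card_long_piece A k n l x0.
set T := #|` strat_fset A k n| in b1 b2 *; set B := #|` _|.
set B1 := #|` _| in b1; set B2 := #|` _| in b2.
have BB : (B <= B1 + B2)%N.
  rewrite -cardfsUI; apply: leq_trans (leq_addr _ _).
  apply: fsubset_leq_card; apply/fsubsetP => P; rewrite !inE /=.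
  by move=> /andP [-> /asboolP /(@not_small_overlap _ _ m l P m0 l0)] /=.
have h1 : (2 * c * B1 <= T)%N.
  rewrite -(@leq_pmul2l (K ^ 2)) ?expn_gt0 ?K0 //.
  have -> : (K ^ 2 * (2 * c * B1) = B1 * c1)%N by rewrite /c1; lia.
  apply: b1; rewrite ?muln_gt0 ?m0 //.
  by apply: leq_trans hl2; rewrite /K; lia.
have h2 : (2 * c * B2 <= T)%N.
  rewrite -(@leq_pmul2l ((K * n.+1) ^ 2)) ?expn_gt0 ?muln_gt0 ?K0 //.
  apply: leq_trans b2; rewrite mulnA [leqRHS]mulnC leq_mul2r; apply/orP; right.
  (* Here the alphabet having at least two letters bounds [#|A| ^ l] below by [2 ^ l]. *)
  apply: (@leq_trans (2 ^ l)); last by rewrite leq_exp2r.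
  by rewrite expnMn; lia.
nia.
Qed.

Theorem theorem1 (R : realType) (A : finType) (k m : nat)
    (hA : (1 < #|A|)%N) (hk : (0 < k)%N) (hm : (0 < m)%N) :
  @generic R (presentation A k) (@sum_length_strat A k)
    [set P : presentation A k | small_overlap m P].
Proof.
rewrite /generic; apply/cvgrPdist_le => e e0.
(* With this [c], a bad share of at most [1 / c.+1] is below the tolerance [e]. *)
have [c ce] : exists c : nat, (e^-1 < c.+1%:R)%R.
  by exists (Num.truncn e^-1); exact: truncnS_gt.
have [N hN] := @bad_negligible A k m c.+1 hA hk hm isT.
exists N => // n /= /hN; set B := [fset _ in _ | _]%fset.
have T0 := @strat_gt0 A k n (ltnW hA) hk.
set X := fset_set _.
rewrite -/(strat_fset A k n).
have mX P : (P \in X) = (P \in strat_fset A k n) && `[< small_overlap m P >].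
  rewrite mem_strat in_fset_set; last first.
    by apply: sub_finite_set (finite_sum_length_strat A k n) => Q [].
  apply/idP/andP => [|[/eqP en /asboolP so]]; rewrite inE; last by split.
  by move=> [so en]; split; [exact/eqP|exact/asboolP].
(* The stratum splits into good and bad presentations, so the distance of the good proportion from 1
   is exactly the bad proportion. *)
have eT : #|` strat_fset A k n| = (#|` X| + #|` B|)%N.
  rewrite -(cardfsID X (strat_fset A k n)); congr addn; congr (size (enum_fset _));
    apply/fsetP => P; rewrite !inE mX ?asbool_neg; by case: (_ \in _); rewrite ?andbT.
rewrite eT in T0 *; move: (#|` X|) (#|` B|) T0 {mX eT} => x b T0 cb.
have xb0 : (0 < (x + b)%:R :> R)%R by rewrite ltr0n.
have -> : (1 - x%:R / (x + b)%:R = b%:R / (x + b)%:R :> R)%R.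
  by rewrite -[X in (X - _)%R](divff (lt0r_neq0 xb0)) -mulrBl natrD addrAC subrr add0r.
rewrite ger0_norm ?divr_ge0 ?ler0n // ler_pdivrMr //.
have cb' : (c.+1%:R * b%:R <= (x + b)%:R :> R)%R by rewrite -natrM ler_nat.
apply: (@le_trans _ _ (e * (c.+1%:R * b%:R))%R); last by rewrite ler_pM2l.
rewrite mulrA ler_peMl ?ler0n //.
by rewrite -ler_pdivrMl // mulr1 ltW.
Qed.
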